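(* Let $X$ be a complex Banach space. If $X$ has the $\mathcal H_p$ random convergence property ($\mathcal H_p$-RCP) for some $2\le p<\infty$, then $$\sup\{r:\ X\text{ has type }r\}=2.$$
   Context: $\mathbb N=\{1,2,\dots\}$, $\mathbb T=\{z\in\mathbb C:|z|=1\}$; $\mathbb T$ and $\mathbb T^{\mathbb N}$ carry normalized Haar measure. $\mathbb Z^{(\mathbb N)}$ and $\mathbb N_0^{(\mathbb N)}$ are the sets of eventually null sequences of integers and of non-negative integers, respectively; $z^\alpha=\prod_i z_i^{\alpha_i}$. Let $p_1<p_2<\cdots$ be the primes; for $\alpha\in\mathbb N_0^{(\mathbb N)}$ put $n(\alpha)=\prod_i p_i^{\alpha_i}$ (a bijection onto $\mathbb N$). Hardy spaces. For $1\le p<\infty$ and $f\in L_p(\mathbb T^{\mathbb N},X)$ (Bochner space), $\hat f(\alpha)=\int_{\mathbb T^{\mathbb N}}f(w)w^{-\alpha}\,dw$. $H_p(\mathbb T^{\mathbb N},X)$ is the closed subspace of those $f\in L_p(\mathbb T^{\mathbb N},X)$ with $\hat f(\alpha)=0$ for all $\alpha\in\mathbb Z^{(\mathbb N)}\setminus\mathbb N_0^{(\mathbb N)}$. A formal Dirichlet series $D=\sum_n x_n n^{-s}$ with $x_n\in X$ belongs to $\mathcal H_p(X)$ if there is $f\in H_p(\mathbb T^{\mathbb N},X)$ with $\hat f(\alpha)=x_{n(\alpha)}$ for all $\alpha\in\mathbb N_0^{(\mathbb N)}$, and then $\|D\|_{\mathcal H_p(X)}=\|f\|_{L_p(\mathbb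 T^{\mathbb N},X)}$. $\mathcal H^{rad}_p(X)$ is the set of formal Dirichlet series $\sum_n x_n n^{-s}$ with $x_n\in X$ such that $\sum_n\varepsilon_n x_n n^{-s}\in\mathcal H_p(X)$ for almost every $(\varepsilon_n)_n\in\{-1,+1\}^{\mathbb N}$ (Haar probability measure). It is normed by $\|\sum_n x_n n^{-s}\|_{\mathcal H^{rad}_p(X)}=\mathbb E\|\sum_n\varepsilon_n x_n n^{-s}\|_{\mathcal H_p(X)}$, where $\mathbb E$ is the expectation over independent uniform signs $\varepsilon_n=\pm1$. A sequence $(y_n)_n$ in a Banach space is RUC if there is a constant $C$ such that $\mathbb E\|\sum_{n=1}^m\varepsilon_n a_n y_n\|\le C\|\sum_{n=1}^m a_n y_n\|$ for every $m\in\mathbb N$ and all scalars $(a_n)_{n=1}^m\subset\mathbb C$. $X$ has the $\mathcal H_p$-RCP ($2\le p<\infty$) if it satisfies any of the following equivalent conditions: (a) $(x_n n^{-s})_n$ is RUC in $\mathcal H_p(X)$ for every $(x_n)_n\subset X$; (b) there is $C\ge1$ with $\|\sum_{n=1}^N x_n n^{-s}\|_{\mathcal H^{rad}_p(X)}\le C\|\sum_{n=1}^N x_n n^{-s}\|_{\mathcal H_p(X)}$ for all $N$ and $(x_n)_{n=1}^N\subset X$; (c) $\mathcal H_p(X)\subseteq\mathcal H^{rad}_p(X)$; (d) there is $C\ge1$ with $\mathbb E\|\sum_{n=1}^N\varepsilon_n x_n\|\le C(\int_{\mathbb T}\|\sum_{n=1}^N x_n z^n\|^p\,dz)^{1/p}$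 for all $N$ and $(x_n)_{n=1}^N\subset X$. For $1\le r\le2$, $X$ has type $r$ if there is $C$ with $(\mathbb E\|\sum_{n=1}^N\varepsilon_n x_n\|^2)^{1/2}\le C(\sum_{n=1}^N\|x_n\|^r)^{1/r}$ for all $N$ and all $x_1,\dots,x_N\in X$. *)

(* Defs.v *)
From HB Require Import structures.
From mathcomp Require Import all_boot all_order all_algebra.
From mathcomp Require Import complex.
From mathcomp Require Import all_classical all_reals all_analysis.
Set Implicit Arguments.
Unset Strict Implicit.
Unset Printing Implicit Defensive.
Import Order.TTheory GRing.Theory Num.Theory.
Import numFieldNormedType.Exports.

Local Open Scope classical_set_scope.
Local Open Scope ring_scope.

(* The norm of a normed module over [R[i]] takes its values in [R[i]];
   it is a nonnegative real there, so taking the real part loses nothing. *)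
Definition rnorm (R : realType) (X : normedModType R[i]) (x : X) : R :=
  complex.Re `|x|.

Definition sign_mean (R : realType) (N : nat)
    (F : {ffun 'I_N -> bool} -> R) : R :=
  (2 ^+ N)^-1 * \sum_(e : {ffun 'I_N -> bool}) F e.

(* [sum_n eps_n x_n], the sign eps_n being [(-1) ^+ e n]. *)
Definition sign_sum (R : realType) (X : normedModType R[i]) (N : nat)
    (x : 'I_N -> X) (e : {ffun 'I_N -> bool}) : X :=
  \sum_(n < N) ((-1) ^+ e n : R[i]) *: x n.

(* Integration over the circle for normalized Haar measure, which is the image
   of Lebesgue measure on [0, 1] under t |-> exp (2 pi i t). *)
Definition circle_integral (R : realType) (F : R[i] -> R) : R :=
  Rintegral (@lebesgue_measure R) `[0, 1]
    (fun t : R => F (Complex (cos (2 * pi * t)) (sin (2 * pi * t)))).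

(* The H_p random convergence property, through its defining inequality between
   random sums and vector-valued polynomials on the circle (equivalent to the
   inclusion of H_p(X) in H_p^rad(X) for Dirichlet series).  The vectors are
   numbered from 0, hence the exponent [n.+1]. *)
Definition Hp_RCP (R : realType) (p : R) (X : normedModType R[i]) : Prop :=
  exists2 C : R, 1 <= C &
    forall (N : nat) (x : 'I_N -> X),
      sign_mean (fun e => rnorm (sign_sum x e)) <=
      C * (circle_integral
             (fun z => rnorm (\sum_(n < N) (z ^+ n.+1) *: x n) `^ p)) `^ p^-1.

Definition has_type (R : realType) (r : R) (X : normedModType R[i]) : Prop :=
  exists C : R,
    forall (N : nat) (x : 'I_N -> X),
      Num.sqrt (sign_mean (fun e => rnorm (sign_sum x e) ^+ 2)) <=
      C * (\sum_(n < N) rnorm (x n) `^ r) `^ r^-1.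

(* Main.v *)
Require Import Defs.
From HB Require Import structures.
From mathcomp Require Import all_boot all_order all_algebra.
From mathcomp Require Import cyclic separable cyclotomic.
From mathcomp Require Import complex ring lra.
From mathcomp Require Import all_classical all_reals all_analysis.
Import Order.TTheory GRing.Theory Num.Theory.
Import numFieldNormedType.Exports.
Set Implicit Arguments.
Unset Strict Implicit.
Unset Printing Implicit Defensive.

Local Open Scope classical_set_scope.
Local Open Scope ring_scope.
Local Open Scope complex_scope.

(** The random convergence property forces type 2 itself, so the supremum is
    a maximum.

    The heart is a bound for vectors in a ball: if all the norms of x_1, ...,
    x_M are at most b, then E ||sum_k e_k x_k|| is at most a constant times
    b sqrt M.  Let w be a primitive M-th root of unity and let
    D(z) = 1 + z + ... + z^(M-1).  The polynomials P_k(z) = D(w^k z)^2 are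
    bumps centred at the M-th roots of unity; the square is there so that the
    sum of their moduli is the sum of the |D(w^k z)|^2.  By Parseval on Z/M this
    sum is exactly M^2 at every point z of the circle, so the polynomial
    sum_k P_k(z) e_k x_k has norm at most M^2 b uniformly in z, whatever the
    signs e_k and whatever the exponent p.  The random convergence property
    transfers this bound to the random sum obtained by attaching independent
    signs d_n to the coefficients of that polynomial.  This random sum is
    sum_k g_k(d) e_k x_k, where g_k is a random sum of the coefficients of P_k;
    their energy is at least M^3 / 2, so Khinchine's inequality bounds E |g_k|
    below by a multiple of M^(3/2).  Averaging over the e_k as well,
    contraction and Jensen's inequality (sign_mean_multiplier) allow g_k to be
    replaced by that lower bound, and
      M^(3/2) E ||sum_k e_k x_k|| <= const M^2 b
    follows (RCP_bounded_vectors).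

    A bound in terms of the number of vectors becomes one in terms of the sum
    of the squared norms by splitting (bounded_vectors_sqr_sum): the vector x_k
    is replaced by m_k copies of x_k / sqrt m_k.  With s = sum_k ||x_k||^2 and N
    the number of vectors, m_k can be chosen so that every copy has squared norm
    at most s / N while there are at most 2 N copies in all; the bound for the
    copies is then a multiple of sqrt s.  It passes to the original vectors by
    Khinchine and contraction again.  Finally the second moment required by the
    definition of type exceeds the square of the first one by at most
    sum_k ||x_k||^2, an inequality of Efron-Stein type (sign_mean_sqr_norm_le). *)

(** * The real-valued norm *)

Section RealNorm.
Context {R : realType}.
Implicit Type X : normedModType R[i].

Lemma rnormE X (x : X) : (rnorm x)%:C = `|x|.
Proof. by rewrite /rnorm RRe_real // ger0_real. Qed.

Lemma rnorm_ge0 X (x : X) : 0 <= rnorm x.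
Proof. by rewrite -ler0c rnormE normr_ge0. Qed.

Lemma rnorm0 X : rnorm (0 : X) = 0.
Proof. by rewrite /rnorm normr0. Qed.

Lemma rnorm_eq0 X (x : X) : rnorm x = 0 -> x = 0.
Proof. by move=> h; apply/eqP; rewrite -normr_eq0 -rnormE h. Qed.

Lemma ler_rnormD X (x y : X) : rnorm (x + y) <= rnorm x + rnorm y.
Proof. by rewrite -lecR rmorphD /= !rnormE ler_normD. Qed.

(** Scalars are viewed in the one-dimensional space [R[i]^o], on which [rnorm] is
    the modulus; sums of signed scalars are then instances of [sign_sum]. *)
Lemma rnormZ X (a : R[i]^o) (x : X) : rnorm (a *: x) = rnorm a * rnorm x.
Proof. by apply: (@complexI R); rewrite rmorphM /= !rnormE normrZ. Qed.

Lemma rnorm_sign b : rnorm ((-1) ^+ b : R[i]^o) = 1.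
Proof. by rewrite /rnorm normr_sign. Qed.

Lemma rnormN X (x : X) : rnorm (- x) = rnorm x.
Proof. by rewrite /rnorm normrN. Qed.

Lemma rnorm_real (c : R) : rnorm (c%:C : R[i]^o) = `|c|.
Proof. by rewrite /rnorm normc_def /= expr0n addr0 sqrtr_sqr. Qed.

Lemma sqr_rnorm (z : R[i]^o) : rnorm z ^+ 2 = complex.Re z ^+ 2 + complex.Im z ^+ 2.
Proof. by apply: (@complexI R); rewrite add_Re2_Im2 rmorphXn /= rnormE. Qed.

Lemma ler_rnorm_sum X (I : finType) (F : I -> X) :
  rnorm (\sum_i F i) <= \sum_i rnorm (F i).
Proof.
elim/big_ind2: _ => [|x a y b ha hb|//]; first by rewrite rnorm0.
exact: le_trans (ler_rnormD _ _) (lerD ha hb).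
Qed.

End RealNorm.

(** * Averages over signs *)

Section SignMean.
Context {R : realType}.

Lemma sign_meanD N (F G : {ffun 'I_N -> bool} -> R) :
  sign_mean (fun e => F e + G e) = sign_mean F + sign_mean G.
Proof. by rewrite /sign_mean big_split mulrDr. Qed.

Lemma sign_meanZ N c (F : {ffun 'I_N -> bool} -> R) :
  sign_mean (fun e => c * F e) = c * sign_mean F.
Proof. by rewrite /sign_mean -mulr_sumr mulrCA. Qed.

Lemma eq_sign_mean N (F G : {ffun 'I_N -> bool} -> R) :
  F =1 G -> sign_mean F = sign_mean G.
Proof. by move=> h; congr (_ * _); apply: eq_bigr. Qed.

Lemma ler_sign_mean N (F G : {ffun 'I_N -> bool} -> R) :
  (forall e, F e <= G e) -> sign_mean F <= sign_mean G.
Proof.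
by move=> h; rewrite ler_wpM2l ?invr_ge0 ?exprn_ge0 //; apply: ler_sum.
Qed.

Lemma sign_mean_const N (c : R) : sign_mean (fun _ : {ffun 'I_N -> bool} => c) = c.
Proof.
rewrite /sign_mean sumr_const card_ffun card_bool card_ord -[c *+ _]mulr_natl.
by rewrite mulrA natrX mulVf ?mul1r // expf_neq0.
Qed.

Lemma sign_mean_ge0 N (F : {ffun 'I_N -> bool} -> R) :
  (forall e, 0 <= F e) -> 0 <= sign_mean F.
Proof. by move=> h; rewrite -(sign_mean_const N 0); apply: ler_sign_mean. Qed.

Lemma sign_mean_exchange M N (F : {ffun 'I_M -> bool} -> {ffun 'I_N -> bool} -> R) :
  sign_mean (fun d => sign_mean (F d)) = sign_mean (fun e => sign_mean (F^~ e)).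
Proof.
rewrite sign_meanZ [RHS]sign_meanZ; rewrite mulrCA; congr (_ * _).
by rewrite /sign_mean exchange_big mulr_sumr -mulr_sumr.
Qed.

(** Symmetry of the signs: this is what decouples one family of signs from
    another. *)
Lemma sign_mean_flip N (d : {ffun 'I_N -> bool}) (F : {ffun 'I_N -> bool} -> R) :
  sign_mean (fun e => F [ffun i => e i (+) d i]) = sign_mean F.
Proof.
congr (_ * _).
rewrite [RHS](reindex_inj
  (h := fun e : {ffun 'I_N -> bool} => [ffun i => e i (+) d i])) //.
move=> e e' /ffunP h; apply/ffunP=> i; have := h i; rewrite !ffunE.
exact: addIb.
Qed.

Definition cons_sign N (b : bool) (e : {ffun 'I_N -> bool}) :
    {ffun 'I_N.+1 -> bool} :=
  [ffun i => oapp e b (unlift ord0 i)].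

Lemma cons_sign0 N b (e : {ffun 'I_N -> bool}) : cons_sign b e ord0 = b.
Proof. by rewrite ffunE unlift_none. Qed.

Lemma cons_sign_lift N b (e : {ffun 'I_N -> bool}) i :
  cons_sign b e (lift ord0 i) = e i.
Proof. by rewrite ffunE liftK. Qed.

Lemma sign_mean0 (F : {ffun 'I_0 -> bool} -> R) e : sign_mean F = F e.
Proof.
rewrite (eq_sign_mean (G := fun=> F e)) ?sign_mean_const // => d.
by congr F; apply/ffunP => -[].
Qed.

Lemma sign_meanS N (F : {ffun 'I_N.+1 -> bool} -> R) :
  sign_mean F =
  (sign_mean (fun e => F (cons_sign false e)) +
   sign_mean (fun e => F (cons_sign true e))) / 2.
Proof.
rewrite /sign_mean -mulrDr exprS invfM [X in X * _]mulrC -!mulrA.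
congr (_ * _); rewrite mulrC; congr (_ / _).
rewrite (reindex (fun p : bool * {ffun 'I_N -> bool} => cons_sign p.1 p.2)) /=;
  last first.
  exists (fun e => (e ord0, [ffun i => e (lift ord0 i)])) => [[b e] _|e _] /=.
    by rewrite cons_sign0; congr pair; apply/ffunP=> i; rewrite !ffunE liftK.
  apply/ffunP=> i; rewrite ffunE; case: unliftP => [j ->|->] //=.
  by rewrite ffunE.
rewrite -(pair_bigA _ (fun b e => F (cons_sign b e))) /=.
by rewrite big_bool addrC.
Qed.

Context {X : normedModType R[i]}.

Lemma sign_sum_cons N (x : 'I_N.+1 -> X) b e :
  sign_sum x (cons_sign b e) =
  (-1) ^+ b *: x ord0 + sign_sum (fun i => x (lift ord0 i)) e.
Proof.
rewrite /sign_sum big_ord_recl cons_sign0; congr (_ + _).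
by apply: eq_bigr => i _; rewrite cons_sign_lift.
Qed.

(** Conditioning on the first sign; the translation by [v] makes statements
    about random sums amenable to induction on the number of signs. *)
Lemma sign_mean_sumS (f : X -> R) (v : X) N (x : 'I_N.+1 -> X) :
  let x' := fun i => x (lift ord0 i) in
  sign_mean (fun e => f (v + sign_sum x e)) =
  (sign_mean (fun e => f ((v + x ord0) + sign_sum x' e)) +
   sign_mean (fun e => f ((v - x ord0) + sign_sum x' e))) / 2.
Proof.
rewrite /= sign_meanS; congr ((_ + _) / 2); apply: eq_sign_mean => e;
  by rewrite sign_sum_cons /= ?expr0 ?expr1 ?scale1r ?scaleN1r addrA.
Qed.

(** Convexity of the norm along the segment from [u - y] to [u + y]. *)
Lemma rnorm_chord (u y : X) (c : R) : `|c| <= 1 ->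
  rnorm (u + c%:C *: y) <=
  (1 + c) / 2 * rnorm (u + y) + (1 - c) / 2 * rnorm (u - y).
Proof.
rewrite ler_norml => /andP[c1 c2].
have -> : u + c%:C *: y =
    ((1 + c) / 2)%:C *: (u + y) + ((1 - c) / 2)%:C *: (u - y).
  rewrite !scalerDr addrACA scalerN -!scalerBl -scalerDl -!rmorphD -rmorphB /=.
  have -> : (1 + c) / 2 + (1 - c) / 2 = 1 by field.
  have -> : (1 + c) / 2 - (1 - c) / 2 = c by field.
  by rewrite scale1r.
apply: le_trans (ler_rnormD _ _) _; rewrite !rnormZ !rnorm_real.
by rewrite !ger0_norm ?divr_ge0 //; lra.
Qed.

(** Averaged over the sign of a vector [y], the norm of [u +- c y] is a convex
    even function of [c], hence largest at the ends of [-1, 1]. *)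
Lemma real_contraction N (c : 'I_N -> R) (x : 'I_N -> X) v :
  (forall i, `|c i| <= 1) ->
  sign_mean (fun e => rnorm (v + sign_sum (fun i => (c i)%:C *: x i) e)) <=
  sign_mean (fun e => rnorm (v + sign_sum x e)).
Proof.
elim: N c x v => [|N IH] c x v hc.
  pose e0 : {ffun 'I_0 -> bool} := [ffun=> false].
  by rewrite !(sign_mean0 _ e0) /sign_sum !big_ord0.
rewrite !(sign_mean_sumS (@rnorm R X)) ler_pM2r ?invr_gt0 //.
pose x' i := x (lift ord0 i).
set c0 := c ord0; set x0 := x ord0.
apply: le_trans (lerD (IH _ x' _ _) (IH _ x' _ _)) _ => [i|i|]; try exact: hc.
rewrite -!sign_meanD; apply: ler_sign_mean => e.
set w := sign_sum _ _.
have h1 := rnorm_chord (v + w) x0 (hc ord0).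
have h2 : `|- c0| <= 1 by rewrite normrN; exact: hc.
have {}h2 := rnorm_chord (v + w) x0 h2.
rewrite -/c0 rmorphN scaleNr /= in h1 h2.
rewrite !(addrAC v _ w); lra.
Qed.

(** The factor 2 is the price of treating the real and imaginary parts of the
    ratios [a i / b i] separately. *)
Lemma complex_contraction N (a b : 'I_N -> R[i]^o) (x : 'I_N -> X) :
  (forall i, rnorm (a i) <= rnorm (b i)) ->
  sign_mean (fun e => rnorm (sign_sum (fun i => a i *: x i) e)) <=
  2 * sign_mean (fun e => rnorm (sign_sum (fun i => b i *: x i) e)).
Proof.
move=> hab.
pose q i : R[i]^o := a i / b i.
have q1 i : complex.Re (q i) ^+ 2 + complex.Im (q i) ^+ 2 <= 1.
  rewrite -sqr_rnorm expr_le1 ?rnorm_ge0 //.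
  rewrite /q /rnorm normf_div -!rnormE -fmorph_div /=.
  have [->|b0] := eqVneq (rnorm (b i)) 0; first by rewrite invr0 mulr0.
  by rewrite ler_pdivrMr ?mul1r ?lt_def ?b0 ?rnorm_ge0.
have qE i : a i *: x i =
    (complex.Re (q i))%:C *: (b i *: x i) +
    (complex.Im (q i))%:C *: (('i * b i) *: x i).
  rewrite !scalerA -scalerDl; congr (_ *: _).
  rewrite mulrA -mulrDl [_ * 'i]mulrC -complexE /q.
  have [b0|b0] := eqVneq (b i) 0; last by rewrite divfK.
  rewrite b0 mulr0; apply: rnorm_eq0; apply/eqP; rewrite eq_le rnorm_ge0 andbT.
  by rewrite (le_trans (hab i)) // b0 rnorm0.
have hi e : rnorm (sign_sum (fun i => ('i * b i) *: x i) e) =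
            rnorm (sign_sum (fun i => b i *: x i) e).
  rewrite -[RHS]mul1r.
  have <- : rnorm ('i : R[i]^o) = 1.
    by rewrite /rnorm normc_def /= expr0n add0r expr1n sqrtr1.
  rewrite -rnormZ; congr rnorm; rewrite scaler_sumr; apply: eq_bigr => i _.
  by rewrite !scalerA !mulrA; congr (_ * _ *: _); rewrite mulrC.
pose yr i := (complex.Re (q i))%:C *: (b i *: x i).
pose yi i := (complex.Im (q i))%:C *: (('i * b i) *: x i).
have split e : sign_sum (fun i => a i *: x i) e = sign_sum yr e + sign_sum yi e.
  rewrite /sign_sum -big_split; apply: eq_bigr => i _ /=.
  by rewrite qE scalerDr.
apply: (@le_trans _ _ (sign_mean (fun e =>
    rnorm (sign_sum yr e) + rnorm (sign_sum yi e)))).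
  by apply: ler_sign_mean => e; rewrite split; exact: ler_rnormD.
rewrite sign_meanD mulr2n mulrDl !mul1r.
have sq1 (s t : R) : s ^+ 2 + t ^+ 2 <= 1 -> `|s| <= 1.
  move=> h; rewrite -(@expr_le1 _ 2) // real_normK ?num_real //.
  by have := sqr_ge0 t; lra.
have ctr c (y : 'I_N -> X) : (forall i, `|c i| <= 1) ->
    sign_mean (fun e => rnorm (sign_sum (fun i => (c i)%:C *: y i) e)) <=
    sign_mean (fun e => rnorm (sign_sum y e)).
  move=> /(real_contraction y 0).
  by under eq_sign_mean do rewrite add0r; under [leRHS]eq_sign_mean do rewrite add0r.
rewrite lerD //; first by apply: ctr => i; apply: sq1 (q1 i).
rewrite -(eq_sign_mean hi); apply: ctr => i.
by apply: (@sq1 _ (complex.Re (q i))); rewrite addrC.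
Qed.

(** Random multipliers can be replaced by a lower bound for their mean modulus.
    Contraction turns [g k d] into its modulus, Jensen's inequality brings the
    mean over [d] inside the norm, and contraction turns the mean moduli into
    [m]; each contraction costs a factor 2. *)
Lemma sign_mean_multiplier M N (g : 'I_N -> {ffun 'I_M -> bool} -> R[i]^o)
    (x : 'I_N -> X) m :
  0 <= m -> (forall k, m <= sign_mean (fun d => rnorm (g k d))) ->
  m * sign_mean (fun e => rnorm (sign_sum x e)) <=
  4 * sign_mean (fun d => sign_mean (fun e =>
        rnorm (sign_sum (fun k => g k d *: x k) e))).
Proof.
move=> m0 hm.
pose E k := sign_mean (fun d => rnorm (g k d)).
have E0 k : 0 <= E k by apply: sign_mean_ge0 => d; exact: rnorm_ge0.
have -> : m * sign_mean (fun e => rnorm (sign_sum x e)) =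
    sign_mean (fun e => rnorm (sign_sum (fun k => m%:C *: x k) e)).
  rewrite -sign_meanZ; apply: eq_sign_mean => e.
  have <- : rnorm (m%:C : R[i]^o) = m by rewrite rnorm_real ger0_norm.
  rewrite -rnormZ; congr rnorm; rewrite rnorm_real scaler_sumr.
  by apply: eq_bigr => i _; rewrite !scalerA mulrC ger0_norm.
apply: (@le_trans _ _ (2 * sign_mean (fun e =>
    rnorm (sign_sum (fun k => (E k)%:C *: x k) e)))).
  by apply: complex_contraction => k; rewrite !rnorm_real !ger0_norm //; exact: hm.
have -> : 4 = 2 * 2 :> R by rewrite -natrM.
rewrite -mulrA ler_pM2l //.
apply: (@le_trans _ _ (sign_mean (fun d => sign_mean (fun e =>
        rnorm (sign_sum (fun k => (rnorm (g k d))%:C *: x k) e))))); last first.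
  rewrite -sign_meanZ; apply: ler_sign_mean => d.
  apply: complex_contraction => k.
  by rewrite rnorm_real ger0_norm ?rnorm_ge0.
rewrite sign_mean_exchange; apply: ler_sign_mean => e.
have -> : sign_sum (fun k => (E k)%:C *: x k) e =
   \sum_(d : {ffun 'I_M -> bool}) ((2 ^+ M)^-1)%:C *:
      sign_sum (fun k => (rnorm (g k d))%:C *: x k) e.
  rewrite /sign_sum; under [RHS]eq_bigr do rewrite scaler_sumr.
  rewrite exchange_big /=; apply: eq_bigr => k _.
  rewrite /E /sign_mean rmorphM rmorph_sum /= mulr_sumr scaler_suml scaler_sumr.
  by apply: eq_bigr => d _; rewrite !scalerA mulrCA.
apply: le_trans (ler_rnorm_sum _) _; rewrite /sign_mean mulr_sumr.
apply: ler_sum => d _; rewrite rnormZ rnorm_real ger0_norm //.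
Qed.

(** The variance of the norm of a random sum is controlled because a change of
    the sign of [x i] moves this norm by at most twice the norm of [x i]:
    conditioning on that sign splits the mean into two values A and B with
    |A - B| <= 2 ||x i||, and (A^2 + B^2) / 2 exceeds ((A + B) / 2)^2 by
    (A - B)^2 / 4 <= ||x i||^2. *)
Lemma sign_mean_sqr_norm_le N (x : 'I_N -> X) v :
  sign_mean (fun e => rnorm (v + sign_sum x e) ^+ 2) <=
  sign_mean (fun e => rnorm (v + sign_sum x e)) ^+ 2 + \sum_i rnorm (x i) ^+ 2.
Proof.
elim: N x v => [|N IH] x v.
  pose e0 : {ffun 'I_0 -> bool} := [ffun=> false].
  by rewrite !(sign_mean0 _ e0) big_ord0 addr0.
rewrite (sign_mean_sumS (fun u => rnorm u ^+ 2)) (sign_mean_sumS (@rnorm R X)) /=.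
rewrite big_ord_recl.
set x' := fun i => x (lift ord0 i).
have h1 := IH x' (v + x ord0); have h2 := IH x' (v - x ord0).
set A := sign_mean (fun e => rnorm (v + x ord0 + _)) in h1 *.
set B := sign_mean (fun e => rnorm (v - x ord0 + _)) in h2 *.
have lip (u w : X) : rnorm u <= rnorm w + rnorm (u - w).
  by have := ler_rnormD w (u - w); rewrite subrKC.
have shift (y : X) : rnorm (y + y) = 2 * rnorm y.
  have -> : y + y = (2%:C : R[i]^o) *: y by rewrite rmorph_nat scaler_nat mulr2n.
  by rewrite rnormZ rnorm_real ger0_norm.
have AB : A <= B + 2 * rnorm (x ord0).
  rewrite -(sign_mean_const N (2 * _)) -sign_meanD; apply: ler_sign_mean => e.
  rewrite -shift; apply: le_trans (lip _ (v - x ord0 + sign_sum x' e)) _.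
  by rewrite lerD2l opprD addrACA subrr addr0 opprB [v + _]addrC addrACA subrr addr0.
have BA : B <= A + 2 * rnorm (x ord0).
  rewrite -(sign_mean_const N (2 * _)) -sign_meanD; apply: ler_sign_mean => e.
  rewrite -shift -(rnormN (x ord0 + _)) opprD.
  apply: le_trans (lip _ (v + x ord0 + sign_sum x' e)) _.
  by rewrite lerD2l opprD addrACA subrr addr0 opprD addrACA subrr add0r.
have := rnorm_ge0 (x ord0).
nra.
Qed.

End SignMean.

(** * Khinchine's inequality *)

Section Khinchine.
Context {R : realType}.

Lemma sign_mean_sqr N (a : 'I_N -> R[i]^o) v :
  sign_mean (fun e => rnorm (v + sign_sum a e) ^+ 2) =
  rnorm v ^+ 2 + \sum_i rnorm (a i) ^+ 2.
Proof.
elim: N a v => [|N IH] a v.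
  by rewrite (sign_mean0 _ [ffun=> false]) /sign_sum !big_ord0 !addr0.
rewrite (sign_mean_sumS (fun u => rnorm u ^+ 2)) /= !IH big_ord_recl !sqr_rnorm.
by case: v (a ord0) => [p q] [r s] /=; field.
Qed.

(** The recursion over the signs uses that the average of |v + a|^4 and
    |v - a|^4 is at most |v|^4 + 6 |v|^2 |a|^2 + |a|^4. *)
Lemma sign_mean_fourth N (a : 'I_N -> R[i]^o) v :
  sign_mean (fun e => rnorm (v + sign_sum a e) ^+ 4) <=
  rnorm v ^+ 4 + 6 * rnorm v ^+ 2 * (\sum_i rnorm (a i) ^+ 2)
    + 3 * (\sum_i rnorm (a i) ^+ 2) ^+ 2.
Proof.
elim: N a v => [|N IH] a v.
  rewrite (sign_mean0 _ [ffun=> false]) /sign_sum !big_ord0 !addr0.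
  by rewrite mulr0 expr0n mulr0 !addr0.
rewrite (sign_mean_sumS (fun u => rnorm u ^+ 4)) /= big_ord_recl.
set a' := fun i => a (lift ord0 i).
set s := \sum_(i < N) _.
have s0 : 0 <= s by apply: sumr_ge0 => i _; exact: sqr_ge0.
rewrite ler_pdivrMr //; apply: le_trans (lerD (IH a' _) (IH a' _)) _.
rewrite -/s; rewrite !(exprM _ 2 2) !sqr_rnorm.
case: v (a ord0) => [p q] [r t] /=.
have := mulr_ge0 s0 (addr_ge0 (sqr_ge0 r) (sqr_ge0 t)).
have := sqr_ge0 (p * t - q * r); have := sqr_ge0 (r ^+ 2 + t ^+ 2).
nra.
Qed.

(** First moments are bounded below by comparing moments of orders 2 and 4: for
    t, s >= 0 the inequality 27 s^3 t >= 27 s^2 t^2 - 4 t^4 holds, since the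
    difference is t (2 t - 3 s)^2 (t + 3 s).  With s^2 the second moment, the
    fourth moment is at most 3 s^4, which leaves 27 s^3 E|S| >= 15 s^4. *)
Lemma khinchine N (a : 'I_N -> R[i]^o) :
  5 / 9 * Num.sqrt (\sum_i rnorm (a i) ^+ 2) <=
  sign_mean (fun e => rnorm (sign_sum a e)).
Proof.
have h2 := sign_mean_sqr a 0; have h4 := sign_mean_fourth a 0.
rewrite rnorm0 !expr0n mulr0 mul0r !add0r in h2 h4.
have E0 : 0 <= sign_mean (fun e => rnorm (sign_sum a e)).
  by apply: sign_mean_ge0 => e; exact: rnorm_ge0.
set V := \sum_i _ in h2 h4 *.
have V0 : 0 <= V by apply: sumr_ge0 => i _; exact: sqr_ge0.
pose s := Num.sqrt V.
rewrite -/s; have [->|s0] := eqVneq s 0; first by rewrite mulr0.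
have {}s0 : 0 < s by rewrite lt_def s0 sqrtr_ge0.
have sV : s ^+ 2 = V by rewrite sqr_sqrtr.
have : 27 * s ^+ 2 * V <= 27 * s ^+ 3 * sign_mean (fun e => rnorm (sign_sum a e))
    + 4 * sign_mean (fun e => rnorm (0 + sign_sum a e) ^+ 4).
  rewrite -h2 -!sign_meanZ -sign_meanD; apply: ler_sign_mean => e.
  rewrite add0r; have := rnorm_ge0 (sign_sum a e); set t := rnorm _ => t0.
  rewrite -subr_ge0.
  have -> : 27 * s ^+ 3 * t + 4 * t ^+ 4 - 27 * s ^+ 2 * t ^+ 2 =
      t * ((2 * t - 3 * s) ^+ 2 * (t + 3 * s)) by ring.
  by rewrite mulr_ge0 // mulr_ge0 ?sqr_ge0 // addr_ge0 // mulr_ge0 // ltW.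
move: sV h4; clearbody s => <- h4 h.
rewrite -(ler_pM2l (exprn_gt0 3 s0)).
set E := sign_mean _ in h *; set F := sign_mean _ in h h4; lra.
Qed.

End Khinchine.

(** * Means on the circle *)

(** The integral of a nonnegative function is a supremum over the simple
    functions below it, and these are also below any pointwise majorant. *)
Lemma Rintegral_le_bound (R : realType) (F : R -> R) (B : R) :
  (forall t, 0 <= F t <= B) ->
  Rintegral (@lebesgue_measure R) `[0, 1] F <= B.
Proof.
move=> FB.
have B0 : 0 <= B by have /andP[/le_trans] := FB 0; apply.
rewrite /Rintegral.
set I := (X in fine X).
have I0 : (0 <= I)%E.
  by apply: integral_ge0 => t _; rewrite lee_fin; case/andP: (FB t).
suff IB : (I <= B%:E)%E.
  by rewrite -lee_fin fineK // ge0_fin_numE // (le_lt_trans IB) // ltry.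
have -> : B%:E = (\int[lebesgue_measure]_(t in `[0%R, 1%R]) (B%:E))%E.
  have m1 : @lebesgue_measure R `[0, 1]%classic = 1%E.
    by rewrite lebesgue_measure_itv /= lte_fin ltr01 oppr0 adde0.
  by rewrite integral_cst // [X in (_ * X)%E]m1 mule1.
rewrite /I !ge0_integralE => [|t _|t _]; rewrite ?lee_fin //;
  last by case/andP: (FB t).
apply: le_ereal_sup => _ /= [h hF <-]; exists h => // t.
apply: (le_trans (hF t)); apply: lee_restrict => u _.
by rewrite lee_fin; case/andP: (FB u).
Qed.

Lemma circle_Lp_le_bound (R : realType) (F : R[i] -> R) (p B : R) : 0 < p ->
  (forall z : R[i], 0 <= F z) -> (forall z : R[i], `|z| = 1 -> F z <= B) ->
  circle_integral (fun z => F z `^ p) `^ p^-1 <= B.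
Proof.
move=> p0 F0 FB.
have B0 : 0 <= B by apply: le_trans (F0 _) (FB 1 (normr1 _)).
have -> : B = (B `^ p) `^ p^-1 by rewrite -powRrM divff ?gt_eqF // powRr1.
apply: ge0_ler_powR; rewrite ?nnegrE ?invr_ge0 ?(ltW p0) ?powR_ge0 //.
  by apply: fine_ge0; apply: integral_ge0 => t _; rewrite lee_fin powR_ge0.
apply: Rintegral_le_bound => t; rewrite powR_ge0 /=.
apply: ge0_ler_powR; rewrite ?nnegrE ?(ltW p0) ?F0 //.
by apply: FB; rewrite normc_def /= cos2Dsin2 sqrtr1.
Qed.

(** * Squared Dirichlet kernels *)

Section Fejer.
Context {R : realType}.

(** Over an algebraically closed field 'X^n - 1 splits, and in characteristic 0
    it is separable, so it has n distinct roots; n distinct n-th roots of unity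
    in a field form a cyclic group. *)
Lemma prim_root_exists n : (0 < n)%N -> exists w : R[i], n.-primitive_root w.
Proof.
move=> n_gt0.
have [rs] := closed_field_poly_normal ('X^n - 1 : {poly R[i]}).
rewrite (monicP _) ?monicXnsubC // scale1r => split_rs.
have rs_uniq : uniq rs.
  rewrite -separable_prod_XsubC -split_rs separable_Xn_sub_1 //.
  by rewrite pnatr_eq0 -lt0n.
have rs_size : (n <= size rs)%N.
  by rewrite -ltnS -(size_prod_XsubC rs id) -split_rs size_XnsubC.
have rs_unity : all n.-unity_root rs.
  by apply/allP => z; rewrite -root_prod_XsubC -split_rs.
by have /hasP[w _ prim_w] := has_prim_root n_gt0 rs_unity rs_uniq rs_size; exists w.
Qed.

Lemma conj_unit (z : R[i]) : `|z| = 1 -> z^* = z^-1.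
Proof.
move=> z1; have z0 : z != 0 by rewrite -normr_eq0 z1 oner_eq0.
by apply: (mulfI z0); rewrite divff // -sqr_normc z1 expr1n.
Qed.

Lemma prim_root_sum M (w : R[i]) (i j : 'I_M) : M.-primitive_root w ->
  \sum_(k < M) (w ^+ k) ^+ i * (w ^+ k) ^- j = (M * (i == j))%:R.
Proof.
move=> prim_w; have M0 := prim_order_gt0 prim_w.
have w0 : w != 0.
  apply/eqP => w0; have := prim_expr_order prim_w.
  by rewrite w0 expr0n gtn_eqF // => /eqP; rewrite eq_sym oner_eq0.
pose q := w ^+ i / w ^+ j.
have -> : \sum_(k < M) (w ^+ k) ^+ i * (w ^+ k) ^- j = \sum_(k < M) q ^+ k.
  apply: eq_bigr => k _; rewrite /q exprMn exprVn -!exprM.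
  by rewrite mulnC [(k * j)%N]mulnC.
case: (eqVneq i j) @q => [->|ij] q.
  under eq_bigr do rewrite /q divff ?expf_neq0 // expr1n.
  by rewrite sumr_const card_ord muln1.
have q1 : q != 1.
  apply: contra ij => /eqP qe; have : w ^+ i = w ^+ j.
    by rewrite -[RHS]mul1r -qe /q divfK ?expf_neq0.
  by move/eqP; rewrite (eq_prim_root_expr prim_w) !modn_small.
suff : (q - 1) * (\sum_(k < M) q ^+ k) == 0.
  by rewrite mulf_eq0 subr_eq0 (negPf q1) muln0 => /eqP.
rewrite -subrX1 /q exprMn exprVn -!exprM ![(_ * M)%N]mulnC !exprM.
by rewrite (prim_expr_order prim_w) !expr1n divff ?oner_eq0 // subrr.
Qed.

Lemma norm_prim_root M (w : R[i]) : M.-primitive_root w -> `|w| = 1.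
Proof.
move=> prim_w; have M0 := prim_order_gt0 prim_w.
by apply/eqP; rewrite -(@pexpr_eq1 _ _ M) // -normrX (prim_expr_order prim_w) normr1.
Qed.

(** Parseval on Z/M, applied to the function k |-> D(w^k z), whose Fourier
    coefficients z^i have modulus 1. *)
Lemma dirichlet_parseval M (w z : R[i]) : M.-primitive_root w -> `|z| = 1 ->
  \sum_(k < M) rnorm (\sum_(i < M) (w ^+ k * z) ^+ i : R[i]^o) ^+ 2 = M%:R ^+ 2.
Proof.
move=> prim_w z1; have w1 := norm_prim_root prim_w.
apply: (@complexI R); rewrite rmorph_sum rmorphXn rmorph_nat /=.
have z0 : z != 0 by rewrite -normr_eq0 z1 oner_eq0.
transitivity (\sum_(k < M) \sum_(i < M) \sum_(j < M)
    (w ^+ k * z) ^+ i * (w ^+ k * z) ^- j).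
  apply: eq_bigr => k _; rewrite rmorphXn /= rnormE sqr_normc rmorph_sum /=.
  rewrite mulr_suml; apply: eq_bigr => i _; rewrite mulr_sumr; apply: eq_bigr => j _.
  by rewrite conj_unit // normrX normrM normrX w1 z1 expr1n mulr1 expr1n.
rewrite exchange_big /=; under eq_bigr do rewrite exchange_big /=.
transitivity (\sum_(i < M) \sum_(j < M) z ^+ i * z ^- j * (M * (i == j))%:R).
  apply: eq_bigr => i _; apply: eq_bigr => j _.
  rewrite -(prim_root_sum i j prim_w) mulr_sumr; apply: eq_bigr => k _.
  by rewrite !exprMn invfM mulrACA mulrC.
transitivity (\sum_(i < M) (M%:R : R[i])).
  apply: eq_bigr => i _; rewrite (bigD1 i) //= big1 ?addr0 => [|j ji].
    by rewrite eqxx muln1 divff ?mul1r // expf_neq0.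
  by rewrite [i == j]eq_sym (negPf ji) muln0 mulr0.
by rewrite sumr_const card_ord expr2 mulr_natr.
Qed.

(** The coefficient of degree [n] in the square of 1 + z + ... + z^(M-1). *)
Definition bump_coef M n : nat := #|[pred p : 'I_M * 'I_M | (p.1 + p.2 == n)%N]|.

Lemma bump_coefE M (w : R[i]) :
  \sum_(n < M + M) (bump_coef M n)%:R * w ^+ n = (\sum_(i < M) w ^+ i) ^+ 2.
Proof.
rewrite expr2 mulr_suml; under [RHS]eq_bigr do rewrite mulr_sumr.
rewrite pair_bigA /=.
have lt (p : 'I_M * 'I_M) : (p.1 + p.2 < M + M)%N.
  by rewrite -addSn leq_add // ltnW.
rewrite [RHS](partition_big (fun p => Ordinal (lt p)) xpredT) //=.
apply: eq_bigr => n _.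
rewrite (eq_bigr (fun=> w ^+ n)) => [|p /eqP<-]; last by rewrite exprD.
rewrite mulr_natl -sumr_const; apply: eq_bigl => p.
by rewrite inE.
Qed.

(** The coefficients sum to M^2 over 2 M degrees, so their mean is M / 2; the
    bound is the inequality c^2 >= M c - M^2 / 4 summed over the degrees. *)
Lemma bump_coef_energy M :
  M%:R ^+ 3 / 2 <= \sum_(n < M + M) (bump_coef M n)%:R ^+ 2 :> R.
Proof.
have sum1 : \sum_(n < M + M) (bump_coef M n)%:R = M%:R ^+ 2 :> R.
  have := bump_coefE M 1; under eq_bigr do rewrite expr1n mulr1.
  under [X in X ^+ 2]eq_bigr do rewrite expr1n.
  rewrite sumr_const card_ord => h; apply: (@complexI R).
  rewrite rmorph_sum rmorphXn rmorph_nat /= -h.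
  by apply: eq_bigr => i _; rewrite rmorph_nat.
apply: (@le_trans _ _ (\sum_(n < M + M)
    (M%:R * (bump_coef M n)%:R - M%:R ^+ 2 / 4))).
  rewrite sumrB -mulr_sumr sum1 sumr_const card_ord -[_ *+ (M + M)]mulr_natl natrD.
  by rewrite le_eqVlt; apply/orP; left; apply/eqP; field.
apply: ler_sum => n _; rewrite -subr_ge0.
have -> : (bump_coef M n)%:R ^+ 2 - (M%:R * (bump_coef M n)%:R - M%:R ^+ 2 / 4) =
  ((bump_coef M n)%:R - M%:R / 2) ^+ 2 :> R by field.
exact: sqr_ge0.
Qed.
End Fejer.

(** * Vectors of bounded norm *)

Section BoundedVectors.
Context {R : realType} {X : normedModType R[i]}.

(** The random convergence property is applied, for each choice of signs [e], to
    the polynomial whose coefficients are [y e]: up to a factor z it is the sum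
    of the bumps D(w^k z)^2 times [(-1) ^+ e k *: x k]. *)
Lemma RCP_bounded_vectors (p : R) : 0 < p -> Hp_RCP p X ->
  exists2 K : R, 0 <= K & forall (M : nat) (x : 'I_M -> X) (b : R),
    (forall k, rnorm (x k) <= b) ->
    sign_mean (fun e => rnorm (sign_sum x e)) ^+ 2 <= K * (M%:R * b ^+ 2).
Proof.
move=> p0 [C C1 hC]; exists (16 * 162 / 25 * C ^+ 2) => [|M x b xb].
  by rewrite mulr_ge0 ?sqr_ge0 // divr_ge0 // mulr_ge0.
have [M0|M0] := posnP M.
  subst M; rewrite mul0r mulr0 (sign_mean0 _ [ffun=> false]) /sign_sum big_ord0.
  by rewrite rnorm0 expr0n.
have [w prim_w] := prim_root_exists (R := R) M0.
pose c k n : R[i]^o := (bump_coef M n)%:R * (w ^+ k) ^+ n.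
pose y (e : {ffun 'I_M -> bool}) (n : 'I_(M + M)) : X :=
  \sum_(k < M) c k n *: ((-1) ^+ e k *: x k).
pose g (k : 'I_M) d := sign_sum (fun n : 'I_(M + M) => c k n) d.
have yg e d : sign_sum (y e) d = sign_sum (fun k => g k d *: x k) e.
  rewrite /sign_sum /y; under eq_bigr do rewrite scaler_sumr.
  rewrite exchange_big /=; apply: eq_bigr => k _.
  rewrite scaler_suml scaler_sumr; apply: eq_bigr => n _.
  by rewrite !scalerA; congr (_ *: _); rewrite mulrA [RHS]mulrC.
have upper e : sign_mean (fun d => rnorm (sign_sum (y e) d)) <= C * (M%:R ^+ 2 * b).
  apply: le_trans (hC _ (y e)) _; rewrite ler_pM2l ?(lt_le_trans _ C1) //.
  apply: circle_Lp_le_bound => // [z|z z1]; first exact: rnorm_ge0.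
  have -> : \sum_(n < M + M) z ^+ n.+1 *: y e n =
      \sum_(k < M) (z * (\sum_(i < M) (w ^+ k * z) ^+ i) ^+ 2) *:
        ((-1) ^+ e k *: x k).
    under eq_bigr do rewrite scaler_sumr.
    rewrite exchange_big; apply: eq_bigr => k _.
    rewrite -bump_coefE mulr_sumr scaler_suml; apply: eq_bigr => n _.
    rewrite [LHS]scalerA; congr (_ *: _); rewrite /c exprMn exprS.
    by rewrite -mulrA; congr (_ * _); rewrite mulrC -mulrA.
  apply: le_trans (ler_rnorm_sum _) _.
  rewrite -(dirichlet_parseval prim_w z1) mulr_suml; apply: ler_sum => k _.
  have rz1 : rnorm (z : R[i]^o) = 1 by rewrite /rnorm z1.
  rewrite !rnormZ rnorm_sign mul1r rz1 mul1r -expr2.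
  by rewrite ler_wpM2l ?sqr_ge0.
have lower k : 5 / 9 * Num.sqrt (M%:R ^+ 3 / 2) <=
    sign_mean (fun d => rnorm (g k d)).
  apply: le_trans (khinchine _); rewrite ler_pM2l ?divr_gt0 //.
  rewrite ler_sqrt; last by apply: sumr_ge0 => *; exact: sqr_ge0.
  apply: le_trans (bump_coef_energy M) _; apply: ler_sum => n _.
  rewrite le_eqVlt; apply/orP; left; apply/eqP; congr (_ ^+ 2).
  rewrite /c /rnorm normrM !normrX (norm_prim_root prim_w) !expr1n mulr1.
  by rewrite normr_nat -(rmorph_nat (real_complex R)).
have m0 : 0 <= 5 / 9 * Num.sqrt (M%:R ^+ 3 / 2) :> R.
  by rewrite mulr_ge0 ?sqrtr_ge0 ?divr_ge0.
have := sign_mean_multiplier x m0 lower.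
rewrite sign_mean_exchange => /le_trans main.
have {main}: 5 / 9 * Num.sqrt (M%:R ^+ 3 / 2) *
    sign_mean (fun e => rnorm (sign_sum x e)) <= 4 * (C * (M%:R ^+ 2 * b)).
  apply: main; rewrite ler_pM2l // -(sign_mean_const M (C * _)).
  by apply: ler_sign_mean => e; under eq_sign_mean do rewrite -yg; exact: upper.
set A := sign_mean _; set N := M%:R.
have A0 : 0 <= A by apply: sign_mean_ge0 => e; exact: rnorm_ge0.
have N0 : 0 < N by rewrite ltr0n.
have s2 : Num.sqrt (N ^+ 3 / 2) ^+ 2 = N ^+ 3 / 2.
  by rewrite sqr_sqrtr // divr_ge0 // exprn_ge0 // ltW.
have b0 : 0 <= b := le_trans (rnorm_ge0 _) (xb (Ordinal M0)).
have C0 : 0 <= C by rewrite (le_trans _ C1).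
move=> h1; clearbody A; have := ler_pM (mulr_ge0 m0 A0) (mulr_ge0 m0 A0) h1 h1.
rewrite -!expr2 !exprMn s2 => h.
rewrite -(ler_pM2l (exprn_gt0 3 N0)).
have -> : N ^+ 3 * (16 * 162 / 25 * C ^+ 2 * (N * b ^+ 2)) =
    162 / 25 * (4 ^+ 2 * (C ^+ 2 * ((N ^+ 2) ^+ 2 * b ^+ 2))) by field.
have -> : N ^+ 3 * A ^+ 2 = 162 / 25 * (5 ^+ 2 * 9^-1 ^+ 2 * (N ^+ 3 / 2) * A ^+ 2)
  by field.
by rewrite ler_pM2l.
Qed.

End BoundedVectors.

(** * Type 2 *)

Section TypeTwo.
Context {R : realType} {X : normedModType R[i]}.

(** Splitting: [x k] is replaced by [m k] copies of [x k] divided by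
    sqrt (m k).  The signs of the copies of [x k], normalized in this way, add
    up to a multiplier [h k] of second moment 1, so that Khinchine's inequality
    bounds its mean modulus below by 5/9. *)
Lemma bounded_vectors_sqr_sum (K : R) : 0 <= K ->
  (forall (M : nat) (x : 'I_M -> X) (b : R), (forall k, rnorm (x k) <= b) ->
    sign_mean (fun e => rnorm (sign_sum x e)) ^+ 2 <= K * (M%:R * b ^+ 2)) ->
  forall (N : nat) (x : 'I_N -> X),
    sign_mean (fun e => rnorm (sign_sum x e)) ^+ 2 <=
    2592 / 25 * K * \sum_n rnorm (x n) ^+ 2.
Proof.
move=> K0 hK N x.
pose r k := rnorm (x k) ^+ 2.
set s := \sum_(n < N) _.
have r0 k : 0 <= r k by exact: sqr_ge0.
have s0 : 0 <= s by apply: sumr_ge0 => k _; exact: r0.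
have rs k : r k <= s.
  by rewrite /s (bigD1 k) //= lerDl; apply: sumr_ge0 => *; exact: r0.
(* Rounding [N * r k / s] up makes each copy have squared norm at most s / N,
   while the number of copies is at most 2 N. *)
pose m k := (Num.truncn (N%:R * r k / s)).+1.
have q0 k : 0 <= N%:R * r k / s by rewrite divr_ge0 // mulr_ge0.
have m_gt0 k : 0 < (m k)%:R :> R by rewrite ltr0n.
have m_lb k : r k / (m k)%:R <= s / N%:R.
  have N0 : 0 < N%:R :> R by rewrite ltr0n (leq_ltn_trans _ (ltn_ord k)).
  rewrite ler_pdivrMr // mulrAC ler_pdivlMr // mulrC.
  have [s00|s_neq0] := eqVneq s 0.
    by rewrite s00 mul0r mulr_ge0_le0 // -s00.
  have s_gt0 : 0 < s by rewrite lt_def s_neq0.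
  by rewrite [s * _]mulrC -ler_pdivrMr // ltW // /m truncnS_gt.
have m_ub k : (m k)%:R <= N%:R * r k / s + 1.
  by rewrite /m -natr1 lerD2r truncn_le.
(* The copies are indexed by [T]; [tau] forgets which copy is meant. *)
pose T : finType := {k : 'I_N & 'I_(m k)}.
pose tau (j : 'I_#|T|) : 'I_N := tag (enum_val j).
have sumT (F : 'I_N -> R) : \sum_(j < #|T|) F (tau j) = \sum_k (m k)%:R * F k.
  transitivity (\sum_(t in T) F (tag t)); first by rewrite [RHS]big_enum_val.
  rewrite -(sig_big_dep xpredT (fun _ _ => true) (fun k _ => F k)) /=.
  by apply: eq_bigr => k _; rewrite sumr_const card_ord mulr_natl.
have card_ub : #|T|%:R <= 2 * N%:R :> R.
  have -> : #|T|%:R = \sum_k (m k)%:R :> R.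
    under eq_bigr do rewrite -[_%:R]mulr1.
    by rewrite -(sumT (fun=> 1)) sumr_const card_ord.
  apply: le_trans (ler_sum _ (fun k _ => m_ub k)) _.
  rewrite big_split /= sumr_const card_ord -mulr_suml -mulr_sumr -/s.
  rewrite mulr2n mulrDl !mul1r lerD2r -mulrA ler_piMr //.
  by have [->|s_neq0] := eqVneq s 0; rewrite ?mul0r // divff.
pose v k : R := (Num.sqrt (m k)%:R)^-1.
have v0 k : 0 <= v k by rewrite invr_ge0 sqrtr_ge0.
have v2 k : v k ^+ 2 = (m k)%:R^-1 by rewrite exprVn sqr_sqrtr // ltW.
pose y j := (v (tau j))%:C *: x (tau j).
have y_le j : rnorm (y j) <= Num.sqrt (s / N%:R).
  rewrite rnormZ rnorm_real ger0_norm //.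
  rewrite -[leLHS]ger0_norm ?mulr_ge0 ?rnorm_ge0 // -sqrtr_sqr ler_wsqrtr //.
  by rewrite exprMn v2 mulrC; exact: m_lb.
pose h (k : 'I_N) d :=
  sign_sum (fun j => (if tau j == k then (v k)%:C else 0) : R[i]^o) d.
have h_lb k : 5 / 9 <= sign_mean (fun d => rnorm (h k d)).
  rewrite -[leLHS]mulr1; apply: le_trans (khinchine _).
  rewrite ler_pM2l ?divr_gt0 // -[leLHS]sqrtr1 ler_wsqrtr //.
  rewrite le_eqVlt; apply/orP; left; apply/eqP.
  transitivity (\sum_(j < #|T|) (if tau j == k then v k ^+ 2 else 0)).
    rewrite (sumT (fun k' => if k' == k then v k ^+ 2 else 0)) (bigD1 k) //=.
    rewrite eqxx big1.
      by rewrite addr0 v2 divff ?gt_eqF.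
    by move=> i /negPf->; rewrite mulr0.
  apply: eq_bigr => j _; case: ifP => _; last by rewrite rnorm0 expr0n.
  by rewrite rnorm_real ger0_norm.
pose lift_sign (e : {ffun 'I_N -> bool}) : {ffun 'I_#|T| -> bool} :=
  [ffun j => e (tau j)].
have regroup e (d : {ffun 'I_#|T| -> bool}) :
    sign_sum y [ffun j => d j (+) lift_sign e j] =
    sign_sum (fun k => h k d *: x k) e.
  rewrite /sign_sum /h /sign_sum.
  under [RHS]eq_bigr do rewrite scaler_suml scaler_sumr.
  rewrite exchange_big /=; apply: eq_bigr => j _.
  rewrite (bigD1 (tau j)) //= big1 => [|k /negPf kj]; last first.
    by rewrite [tau j == k]eq_sym kj scaler0 scale0r scaler0.
  rewrite addr0 eqxx !ffunE /y !scalerA signr_addb; congr (_ *: _).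
  by rewrite mulrAC mulrC.
(* Multiplying the signs of all the copies of [x k] by [e k] preserves their
   law, so the mean over the signs of the copies is the same for every [e]. *)
have flip e : sign_mean (fun d => rnorm (sign_sum (fun k => h k d *: x k) e)) =
    sign_mean (fun d => rnorm (sign_sum y d)).
  rewrite -(sign_mean_flip (lift_sign e) (fun d => rnorm (sign_sum y d))).
  by apply: eq_sign_mean => d /=; rewrite regroup.
have := sign_mean_multiplier x (divr_ge0 (ler0n R 5) (ler0n R 9)) h_lb.
rewrite sign_mean_exchange (eq_sign_mean flip) sign_mean_const => main.
have := hK _ y _ y_le.
rewrite sqr_sqrtr ?divr_ge0 //.
set A := sign_mean _ in main *; set B := sign_mean _ in main *.
have A0 : 0 <= A by apply: sign_mean_ge0 => e; exact: rnorm_ge0.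
have Ts : #|T|%:R * (s / N%:R) <= 2 * s.
  apply: le_trans (ler_wpM2r _ card_ub) _; first by rewrite divr_ge0.
  rewrite -mulrA ler_pM2l // mulrCA ler_piMr //.
  by have [->|n0] := eqVneq N 0%N; rewrite ?mul0r // divff // pnatr_eq0.
move: (ler_wpM2l K0 Ts) main; clearbody A B s => hT main hB.
have B_ub : B ^+ 2 <= K * (2 * s) by exact: le_trans hB hT.
have : (5 / 9 * A) * (5 / 9 * A) <= 4 * B * (4 * B).
  by apply: ler_pM => //; rewrite mulr_ge0.
rewrite -!expr2 !exprMn; lra.
Qed.

Lemma sqr_sum_type2 (K : R) : 0 <= K ->
  (forall (N : nat) (x : 'I_N -> X),
    sign_mean (fun e => rnorm (sign_sum x e)) ^+ 2 <= K * \sum_n rnorm (x n) ^+ 2) ->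
  has_type 2 X.
Proof.
move=> K0 hK; exists (Num.sqrt (K + 1)) => N x.
have -> : \sum_(n < N) rnorm (x n) `^ 2 = \sum_n rnorm (x n) ^+ 2.
  by apply: eq_bigr => n _; rewrite powR_mulrn ?rnorm_ge0.
have s0 : 0 <= \sum_(n < N) rnorm (x n) ^+ 2 by apply: sumr_ge0 => *; exact: sqr_ge0.
rewrite powR12_sqrt // -sqrtrM ?addr_ge0 // ler_wsqrtr // mulrDl mul1r.
have := sign_mean_sqr_norm_le x 0.
under eq_sign_mean do rewrite add0r.
under [X in _ <= X ^+ 2 + _]eq_sign_mean do rewrite add0r.
by move=> /le_trans; apply; rewrite lerD2r.
Qed.

End TypeTwo.

Theorem theorem4p3 (R : realType) (X : completeNormedModType R[i])
    (p : R) (hp : 2 <= p) (hX : Hp_RCP p X) :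
  sup [set r : R | 1 <= r <= 2 /\ has_type r X] = 2.
Proof.
have [|K K0 hK] := RCP_bounded_vectors _ hX; first exact: lt_le_trans hp.
have type2 : has_type 2 X.
  have c0 : 0 <= 2592 / 25 :> R by rewrite divr_ge0 ?ler0n.
  exact: (sqr_sum_type2 (mulr_ge0 c0 K0) (bounded_vectors_sqr_sum K0 hK)).
set S := [set r | _].
have S2 : S 2 by split=> //; rewrite ler1n lexx.
have ubS : ubound S 2 by move=> r [/andP[]].
apply/eqP; rewrite eq_le ge_sup ?ub_le_sup //; first by exists 2.
by exists 2.
Qed.
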